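(* Every PBF matrix is banded totally positive. That is, if $T\in\mathbb{R}^{n\times n}$ can be written as $T=L_1\cdots L_p\,D\,U_q\cdots U_1$ with each $L_i$ a positive lower bidiagonal unitriangular $n\times n$ matrix, each $U_i$ a positive upper bidiagonal unitriangular $n\times n$ matrix, and $D$ an $n\times n$ diagonal matrix with positive diagonal entries, then $T$ is banded totally positive.
   Context: A positive lower (upper) bidiagonal unitriangular matrix is one with ones on the main diagonal, strictly positive entries at every position of the first subdiagonal (first superdiagonal), and zeros elsewhere. A matrix is PBF (positive bidiagonal factorization) if it admits a factorization as in the claim. For integers $p,q\ge 0$, a matrix $T\in\mathbb{R}^{n\times n}$ belongs to $B_{p,q}$ if $T_{i,j}=0$ whenever $j>i+q$ or $i>j+p$. For increasing sequences $i_1<\dots<i_r$ and $j_1<\dots<j_r$ in $\{1,\dots,n\}$, the minor $\det(T_{i_k,j_l})_{k,l=1}^r$ of $T\in B_{p,q}$ is trivial with respect to $(p,q)$ if there is $k$ with $j_k>i_k+q$ or $i_k>j_k+p$; otherwise it is nontrivial. A matrix is banded totally positive if, for some $p,q\ge0$, it belongs to $B_{p,q}$ and all its nontrivial minors with respect to $(p,q)$ are positive. *)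

(* Defs.v *)
From HB Require Import structures.
From mathcomp Require Import all_boot all_order all_algebra.
From mathcomp Require Import reals.

Set Implicit Arguments.
Unset Strict Implicit.
Unset Printing Implicit Defensive.

Import Order.TTheory GRing.Theory Num.Theory.
Local Open Scope ring_scope.

Definition pos_lower_bidiagonal (R : realType) (n : nat) (A : 'M[R]_n) : Prop :=
  forall i j : 'I_n,
    [/\ i = j -> A i j = 1,
        i = j.+1 :> nat -> 0 < A i j &
        i != j -> i != j.+1 :> nat -> A i j = 0].

Definition pos_upper_bidiagonal (R : realType) (n : nat) (A : 'M[R]_n) : Prop :=
  forall i j : 'I_n,
    [/\ i = j -> A i j = 1,
        j = i.+1 :> nat -> 0 < A i j &
        i != j -> j != i.+1 :> nat -> A i j = 0].

Definition pos_diagonal (R : realType) (n : nat) (D : 'M[R]_n) : Prop :=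
  is_diag_mx D /\ forall i : 'I_n, 0 < D i i.

(* Factors are numbered from 0.  The product of the L's is taken in increasing
   order of the index and that of the U's in decreasing order; p and q may be
   0, in which case the corresponding product is the identity matrix. *)
Definition PBF (R : realType) (n : nat) (T : 'M[R]_n) : Prop :=
  exists (p q : nat) (L : 'I_p -> 'M[R]_n) (D : 'M[R]_n)
         (U : 'I_q -> 'M[R]_n),
    [/\ forall i, pos_lower_bidiagonal (L i),
        pos_diagonal D,
        forall i, pos_upper_bidiagonal (U i) &
        T = (\prod_(i < p) L i) *m D *m (\prod_(i < q) U (rev_ord i))].

Definition banded (R : realType) (n p q : nat) (T : 'M[R]_n) : Prop :=
  forall i j : 'I_n, (i + q < j)%N || (j + p < i)%N -> T i j = 0.

Definition increasing_seq (r n : nat) (f : 'I_r -> 'I_n) : Prop :=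
  forall k l : 'I_r, (k < l)%N -> (f k < f l)%N.

(* Triviality depends on the index sequences and on (p, q) only, not on the
   entries of the matrix. *)
Definition trivial_minor (p q r n : nat) (f g : 'I_r -> 'I_n) : Prop :=
  exists k : 'I_r, (f k + q < g k)%N || (g k + p < f k)%N.

Definition banded_totally_positive (R : realType) (n : nat) (T : 'M[R]_n) :
    Prop :=
  exists p q : nat,
    banded p q T /\
    forall (r : nat) (f g : 'I_r -> 'I_n),
      increasing_seq f -> increasing_seq g -> ~ trivial_minor p q f g ->
      0 < \det (mxsub f g T).

(* Main.v *)
Require Import Defs.
From mathcomp Require Import all_boot all_order all_algebra.
From mathcomp Require Import reals.
From mathcomp Require Import perm zify.

(** Multiplying by one positive bidiagonal factor enlarges the band by one and
    preserves the positivity of the nontrivial minors.  By multilinearity in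
    the rows, a minor of [L *m A] with row sequence [f] is a nonnegative
    combination of minors of [A] whose row sequences [phi] satisfy
    [phi k = f k] or [phi k = f k - 1]; such a [phi] is weakly increasing, so
    the minor of [A] vanishes or has increasing indices.  Lowering exactly those
    [f k] that lie on the new outermost subdiagonal gives a positive term. *)

Set Implicit Arguments.
Unset Strict Implicit.
Unset Printing Implicit Defensive.

Import Order.TTheory GRing.Theory Num.Theory.
Local Open Scope ring_scope.

(** Row [i] of [B *m C] is the combination of the rows of [C] with coefficients [B i j];
    multilinearity gives one term per choice [phi] of a row of [C] for each [i]. Unlike in
    Cauchy-Binet, [phi] is arbitrary. *)
Lemma det_mulmx_expand (R : comPzRingType) (r n : nat)
    (B : 'M[R]_(r, n)) (C : 'M[R]_(n, r)) :
  \det (B *m C) =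
    \sum_(phi : {ffun 'I_r -> 'I_n}) (\prod_i B i (phi i)) * \det (rowsub phi C).
Proof.
transitivity (\sum_(phi : {ffun 'I_r -> 'I_n}) \sum_(s : 'S_r)
    (-1) ^+ s * \prod_i (B i (phi i) * C (phi i) (s i))).
  rewrite exchange_big; apply: eq_bigr => /= s _; rewrite -big_distrr /=.
  by congr (_ * _); rewrite -(bigA_distr_bigA (fun i j => B i j * C j (s i)));
     apply: eq_bigr => i _; rewrite mxE.
apply: eq_bigr => phi _; rewrite /determinant big_distrr /=.
apply: eq_bigr => s _; rewrite big_split /= mulrCA; congr (_ * (_ * _)).
by apply: eq_bigr => i _; rewrite mxE.
Qed.

Lemma det_row0 (R : comPzRingType) (r : nat) (A : 'M[R]_r) (i : 'I_r) :
  (forall j, A i j = 0) -> \det A = 0.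
Proof.
by move=> Ai0; rewrite (expand_det_row _ i) big1 // => j _; rewrite Ai0 mul0r.
Qed.

(** Nonnegativity of the trivial minors is included because they occur as terms in the expansion of
    nontrivial minors of a product. *)
Definition minors_positive (R : realType) (n p q : nat) (A : 'M[R]_n) : Prop :=
  forall (r : nat) (f g : 'I_r -> 'I_n), increasing_seq f -> increasing_seq g ->
    0 <= \det (mxsub f g A) /\ (~ trivial_minor p q f g -> 0 < \det (mxsub f g A)).

Lemma not_trivial_minorP (p q r n : nat) (f g : 'I_r -> 'I_n) :
  ~ trivial_minor p q f g <->
  forall k, (g k <= f k + q)%N /\ (f k <= g k + p)%N.
Proof.
split=> [nt k|H [k]]; last by have := H k; lia.
have: ~~ ((f k + q < g k)%N || (g k + p < f k)%N).
  by apply/negP => tk; apply: nt; exists k.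
lia.
Qed.

Lemma banded_tr (R : realType) (n p q : nat) (A : 'M[R]_n) :
  banded p q A -> banded q p A^T.
Proof. by move=> bA i j ij; rewrite mxE bA // orbC. Qed.

Lemma minors_positive_tr (R : realType) (n p q : nat) (A : 'M[R]_n) :
  minors_positive p q A -> minors_positive q p A^T.
Proof.
move=> mA r f g incf incg; rewrite -[mxsub f g _]trmxK det_tr trmx_mxsub trmxK.
have [mA0 mA1] := mA r g f incg incf; split=> // /not_trivial_minorP nt.
by apply/mA1/not_trivial_minorP => k; have [] := nt k.
Qed.

Lemma pos_upper_bidiagonal_tr (R : realType) (n : nat) (U : 'M[R]_n) :
  pos_upper_bidiagonal U -> pos_lower_bidiagonal U^T.
Proof.
move=> posU i j; rewrite mxE; have [U1 U2 U3] := posU j i.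
by split=> [ij|//|ij]; [apply: U1 | apply: U3; rewrite eq_sym].
Qed.

Lemma pos_lower_bidiagonal_ge0 (R : realType) (n : nat) (L : 'M[R]_n) i j :
  pos_lower_bidiagonal L -> 0 <= L i j.
Proof.
move=> /(_ i j) [L1 L2 L3]; have [/L1-> //|ij] := eqVneq i j.
have [/L2/ltW //|ij1] := eqVneq (i : nat) j.+1.
by rewrite L3.
Qed.

Lemma pos_lower_bidiagonal_neq0 (R : realType) (n : nat) (L : 'M[R]_n) i j :
  pos_lower_bidiagonal L -> L i j != 0 -> (j <= i <= j.+1)%N.
Proof.
move=> /(_ i j) [_ _ L3]; apply: contraR => ij.
by apply/eqP/L3; rewrite -?val_eqE /=; lia.
Qed.

Lemma banded_mull (R : realType) (n p q : nat) (L A : 'M[R]_n) :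
  pos_lower_bidiagonal L -> banded p q A -> banded p.+1 q (L *m A).
Proof.
move=> posL bA i j ij; rewrite mxE big1 // => k _.
have [->|Lik] := eqVneq (L i k) 0; first by rewrite mul0r.
have := pos_lower_bidiagonal_neq0 posL Lik => ik.
by rewrite bA ?mulr0 //; lia.
Qed.

Lemma minors_positive_mull (R : realType) (n p q : nat) (L A : 'M[R]_n) :
  pos_lower_bidiagonal L -> minors_positive p q A ->
  minors_positive p.+1 q (L *m A).
Proof.
move=> posL mA r f g incf incg.
have -> : mxsub f g (L *m A) = rowsub f L *m colsub g A.
  by apply/matrixP => i j; rewrite !mxE; apply: eq_bigr => k _; rewrite !mxE.
rewrite det_mulmx_expand.
have subE (phi : 'I_r -> 'I_n) : rowsub phi (colsub g A) = mxsub phi g A.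
  by apply/matrixP => i j; rewrite !mxE.
under eq_bigr => phi _ do rewrite subE.
have coef_ge0 (phi : {ffun 'I_r -> 'I_n}) : 0 <= \prod_i rowsub f L i (phi i).
  by apply: prodr_ge0 => i _; rewrite mxE pos_lower_bidiagonal_ge0.
have term_ge0 (phi : {ffun 'I_r -> 'I_n}) :
    0 <= (\prod_i rowsub f L i (phi i)) * \det (mxsub phi g A).
  have [->|] := eqVneq (\prod_i rowsub f L i (phi i)) 0; first by rewrite mul0r.
  move=> /prodf_neq0 coef_neq0; apply: mulr_ge0 => //.
  have near i : (phi i <= f i <= (phi i).+1)%N.
    by apply: (pos_lower_bidiagonal_neq0 posL); have := coef_neq0 i isT; rewrite mxE.
  have [/injectiveP inj|/injectivePn[i [j ij eqij]]] := boolP (injectiveb phi).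
    apply: (mA r phi g _ incg).1 => k l kl.
    (* [near] gives [phi k <= f k <= f l - 1 <= phi l]; injectivity makes the inequality strict. *)
    have : phi k != phi l by rewrite (inj_eq inj) -val_eqE /=; lia.
    by rewrite -val_eqE /=; have := incf k l kl; have := near k; have := near l; lia.
  by rewrite (determinant_alternate ij) // => k; rewrite !mxE eqij.
split=> [|/not_trivial_minorP nt]; first exact: sumr_ge0.
(* As a number, [lower k] is 1 on the new outermost subdiagonal, where [f k] is positive and the
   subtraction is not truncated, and 0 elsewhere. *)
pose lower k := (f k == g k + p.+1 :> nat)%N.
have lowerP k : (f k - lower k < n)%N by have := ltn_ord (f k); lia.
pose phi := [ffun k => Ordinal (lowerP k)].
have phiE k : phi k = (f k - lower k)%N :> nat by rewrite ffunE.
rewrite (bigD1 phi) //=; apply: ltr_pwDl; last exact: sumr_ge0.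
apply: mulr_gt0.
  apply: prodr_gt0 => k _; rewrite mxE.
  have [L1 L2 _] := posL (f k) (phi k).
  have := phiE k; rewrite /lower; case: eqP => [fk|_] phik.
    by apply: L2; lia.
  by rewrite L1 //; apply: val_inj; rewrite [RHS]phik subn0.
apply: (mA r phi g _ incg).2.
  (* A collision would need [l] lowered, [k] not, and [f l = f k + 1]. Then
     [f k = g l + p >= g k + p + 1], so [nt k] forces equality and [k] is lowered as well. *)
  move=> k l kl; rewrite !phiE /lower.
  by have := incf k l kl; have := incg k l kl; have := nt k; have := nt l; lia.
by apply/not_trivial_minorP => k; rewrite phiE /lower; have := nt k; lia.
Qed.

Lemma banded_diag (R : realType) (n : nat) (D : 'M[R]_n) :
  is_diag_mx D -> banded 0 0 D.
Proof. by move=> /is_diag_mxP diagD i j ij; apply: diagD; lia. Qed.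

(** For the band (0, 0), nontrivial means [f =1 g], and the minor is then a product of diagonal
    entries. A nonzero minor forces [f =1 g], so all the others vanish. *)
Lemma minors_positive_diag (R : realType) (n : nat) (D : 'M[R]_n) :
  pos_diagonal D -> minors_positive 0 0 D.
Proof.
move=> [/is_diag_mxP diagD posD] r f g incf incg.
have det_gt0 : f =1 g -> 0 < \det (mxsub f g D).
  move=> fg; rewrite det_trig.
    by apply: prodr_gt0 => i _; rewrite mxE fg.
  apply/is_trig_mxP => i j ij; rewrite mxE diagD // -fg.
  by have := incf i j ij; lia.
split=> [|/not_trivial_minorP nt]; last first.
  by apply: det_gt0 => k; apply: val_inj => /=; have := nt k; lia.
have [->//|det_neq0] := eqVneq (\det (mxsub f g D)) 0.
apply/ltW/det_gt0 => k.
have [m] := ubnP (k : nat); elim: m k => // m IH k km.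
(* At the first index where [f] and [g] differ, the minor has a zero row or a
   zero column. *)
have before (l : 'I_r) : (l < k)%N -> f l = g l by move=> lk; apply: IH; lia.
have inc_le (h : 'I_r -> 'I_n) (l : 'I_r) : increasing_seq h -> (k <= l)%N -> (h k <= h l)%N.
  move=> inch; rewrite leq_eqVlt => /orP[/eqP/val_inj-> //|kl].
  exact: ltnW (inch k l kl).
have [fg|gf|/val_inj //] := ltngtP (f k) (g k); case/eqP: det_neq0.
  apply: (det_row0 (i := k)) => l; rewrite mxE diagD //.
  have [lk|kl] := ltnP l k; last by have := inc_le g l incg kl; lia.
  by rewrite -before //; have := incf l k lk; lia.
rewrite -det_tr; apply: (det_row0 (i := k)) => l; rewrite !mxE diagD //.
have [lk|kl] := ltnP l k; last by have := inc_le f l incf kl; lia.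
by rewrite before //; have := incg l k lk; lia.
Qed.

Lemma minors_positive_mull_prod (R : realType) (n m p q : nat)
    (L : 'I_m -> 'M[R]_n) (A : 'M[R]_n) :
  (forall i, pos_lower_bidiagonal (L i)) ->
  banded p q A /\ minors_positive p q A ->
  banded (m + p) q ((\prod_i L i) *m A) /\
    minors_positive (m + p) q ((\prod_i L i) *m A).
Proof.
elim: m L => [|m IH] L posL pA; first by rewrite big_ord0 mul1mx.
have [bLA mLA] := IH (fun i => L (lift ord0 i)) (fun i => posL _) pA.
(* The ring product in the big operator is convertible to [*m]; the outermost factor is peeled
   off. *)
rewrite big_ord_recl -[_ * _]/(_ *m _) -mulmxA.
by split; [apply: banded_mull | apply: minors_positive_mull].
Qed.

(** Transposition swaps [p] and [q] and turns right multiplication by an upper factor into left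
    multiplication by a lower one. *)
Lemma minors_positive_mulr_prod (R : realType) (n m p q : nat)
    (U : 'I_m -> 'M[R]_n) (A : 'M[R]_n) :
  (forall i, pos_upper_bidiagonal (U i)) ->
  banded p q A /\ minors_positive p q A ->
  banded p (m + q) (A *m \prod_i U i) /\
    minors_positive p (m + q) (A *m \prod_i U i).
Proof.
elim: m U => [|m IH] U posU pA; first by rewrite big_ord0 mulmx1.
have [bAU mAU] := IH (fun i => U (widen_ord (leqnSn m) i)) (fun i => posU _) pA.
rewrite big_ord_recr /= -[_ * _]/(_ *m _) mulmxA -[_ *m U _]trmxK trmx_mul.
have posUT := pos_upper_bidiagonal_tr (posU ord_max).
split; first exact/banded_tr/banded_mull/banded_tr.
exact/minors_positive_tr/minors_positive_mull/minors_positive_tr.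
Qed.

Theorem proposition2p21 (R : realType) (n : nat) (T : 'M[R]_n) :
  PBF T -> banded_totally_positive T.
Proof.
move=> [p [q [L [D [U [posL posD posU ->]]]]]].
have pD := conj (banded_diag posD.1) (minors_positive_diag posD).
have [bT mT] := minors_positive_mulr_prod (fun i => posU (rev_ord i))
  (minors_positive_mull_prod posL pD).
(* The zeros are the bandwidths of [D]. *)
by exists (p + 0)%N, (q + 0)%N; split=> // r f g incf incg /(mT r f g incf incg).2.
Qed.
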